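(* (Projective triple quad formula) Let $F=(d:e:f)$ be a non-degenerate form over a field, and let $a_1,a_2,a_3$ be non-null p-points, with p-quadrances $q_1\equiv q(a_2,a_3)$, $q_2\equiv q(a_1,a_3)$ and $q_3\equiv q(a_1,a_2)$ relative to $F$. Then $$(q_1+q_2+q_3)^2=2\left(q_1^2+q_2^2+q_3^2\right)+4q_1q_2q_3.$$
   Context: Fix a field, whose elements are called numbers. A projective point, or p-point, is a proportion $a=[x:y]$ with $x,y$ numbers not both zero, where $[x_1:y_1]=[x_2:y_2]$ precisely when $x_1y_2-x_2y_1=0$. A form is a proportion $F=(d:e:f)$ of numbers not all zero, considered up to multiplication by a non-zero number; it is non-degenerate when $df-e^2\neq 0$. Relative to a fixed non-degenerate form $F=(d:e:f)$: a p-point $[x:y]$ is null precisely when $dx^2+2exy+fy^2=0$. The p-quadrance between non-null p-points $a_1=[x_1:y_1]$ and $a_2=[x_2:y_2]$ is the number $$q(a_1,a_2)\equiv\frac{(df-e^2)(x_1y_2-x_2y_1)^2}{(dx_1^2+2ex_1y_1+fy_1^2)(dx_2^2+2ex_2y_2+fy_2^2)}.$$ *)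

(* Defs.v *)
From HB Require Import structures.
From mathcomp Require Import all_boot all_order all_algebra.
From mathcomp Require Import generic_quotient.
From mathcomp Require Import boolp.
From mathcomp Require Import ring.

Set Implicit Arguments.
Unset Strict Implicit.
Unset Printing Implicit Defensive.

Import GRing.Theory.
Local Open Scope ring_scope.
Local Open Scope quotient_scope.

(* Functions on the quotient types [ppoint] and [qform] are computed on [repr];
   [ppoint_eqP], [qform_eqP], [qform_nondegenerateE], [is_nullE] and
   [quadranceE] show that their values do not depend on the choice of
   representatives. *)

Section Proportions.
Variable K : fieldType.

Definition coords2 := {v : K * K | v != (0, 0)}.

Definition coords3 := {u : K * K * K | u != (0, 0, 0)}.

Definition same_ppoint (v w : coords2) : bool :=
  let: (x1, y1) := val v in
  let: (x2, y2) := val w in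
  x1 * y2 - x2 * y1 == 0.

Definition same_qform (u u' : coords3) : bool :=
  let: (d, e, f) := val u in
  `[< exists2 c : K, c != 0 & val u' = (c * d, c * e, c * f) >].

Lemma same_ppointP (v w : coords2) :
  reflect (exists2 c : K, c != 0 & val w = (c * (val v).1, c * (val v).2))
          (same_ppoint v w).
Proof.
case: v w => [[x1 y1] n1] [[x2 y2] n2]; rewrite /same_ppoint /=.
move: n1 n2; rewrite !xpair_eqE !negb_and => n1 n2.
apply: (iffP eqP) => [/eqP|[c _ [-> ->]]]; last by ring.
rewrite subr_eq0 => /eqP E.
have [x0|x0] := eqVneq x1 0.
  have y0 : y1 != 0 by move: n1; rewrite x0 eqxx.
  have x20 : x2 = 0.
    by apply/eqP; move/eqP: E; rewrite x0 mul0r eq_sym mulf_eq0 (negPf y0) orbF.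
  have y20 : y2 != 0 by move: n2; rewrite x20 eqxx.
  exists (y2 / y1); first by rewrite mulf_neq0 ?invr_neq0.
  by rewrite x0 x20 mulr0 divfK.
have x20 : x2 != 0.
  apply/eqP => x20; move: n2; rewrite x20 eqxx /=.
  by move/eqP: E; rewrite x20 mul0r mulf_eq0 (negPf x0) /= => ->.
exists (x2 / x1); first by rewrite mulf_neq0 ?invr_neq0.
by rewrite divfK // mulrAC -E mulrC mulKf.
Qed.

Lemma same_ppoint_refl : reflexive same_ppoint.
Proof. by move=> [[x y] n]; rewrite /same_ppoint /= subrr. Qed.

Lemma same_ppoint_sym : symmetric same_ppoint.
Proof.
move=> [[x y] n] [[x' y'] n']; rewrite /same_ppoint /= -oppr_eq0.
by congr (_ == _); ring.
Qed.

Lemma same_ppoint_trans : transitive same_ppoint.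
Proof.
move=> v u w /same_ppointP[c c0 Ev] /same_ppointP[c' c0' Ew].
apply/same_ppointP; exists (c' * c); first by rewrite mulf_neq0.
by rewrite Ew Ev /= !mulrA.
Qed.

Canonical same_ppoint_equiv :=
  EquivRel same_ppoint same_ppoint_refl same_ppoint_sym same_ppoint_trans.

Lemma same_qformP (u u' : coords3) :
  reflect (exists2 c : K, c != 0 &
             val u' = (c * (val u).1.1, c * (val u).1.2, c * (val u).2))
          (same_qform u u').
Proof. by case: u => [[[d e] f] n]; exact: asboolP. Qed.

Lemma same_qform_refl : reflexive same_qform.
Proof.
move=> [[[d e] f] n]; apply/same_qformP.
by exists 1; rewrite ?oner_neq0 //= !mul1r.
Qed.

Lemma same_qform_sym : symmetric same_qform.
Proof.
suff H u u' : same_qform u u' -> same_qform u' u by move=> u u'; apply/idP/idP; exact: H.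
move=> /same_qformP[c c0 E]; apply/same_qformP; exists c^-1; first by rewrite invr_neq0.
by rewrite E /= !mulKf //; case: (val u) => [[]].
Qed.

Lemma same_qform_trans : transitive same_qform.
Proof.
move=> v u w /same_qformP[c c0 Ev] /same_qformP[c' c0' Ew].
apply/same_qformP; exists (c' * c); first by rewrite mulf_neq0.
by rewrite Ew Ev /= !mulrA.
Qed.

Canonical same_qform_equiv :=
  EquivRel same_qform same_qform_refl same_qform_sym same_qform_trans.

Definition ppoint := {eq_quot same_ppoint}.

Definition qform := {eq_quot same_qform}.

Definition ppoint_of (x y : K) (n0 : (x, y) != (0, 0)) : ppoint :=
  \pi_ppoint (exist _ (x, y) n0).

Definition qform_of (d e f : K) (n0 : (d, e, f) != (0, 0, 0)) : qform :=
  \pi_qform (exist _ (d, e, f) n0).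

Definition qform_disc (u : K * K * K) : K :=
  let: (d, e, f) := u in d * f - e ^+ 2.

Definition qform_val (u : K * K * K) (v : K * K) : K :=
  let: (d, e, f) := u in
  let: (x, y) := v in
  d * x ^+ 2 + 2 * e * x * y + f * y ^+ 2.

Definition cross (v w : K * K) : K :=
  let: (x1, y1) := v in
  let: (x2, y2) := w in
  x1 * y2 - x2 * y1.

Definition qform_nondegenerate (F : qform) : bool :=
  qform_disc (val (repr F)) != 0.

Definition is_null (F : qform) (a : ppoint) : bool :=
  qform_val (val (repr F)) (val (repr a)) == 0.

(* Only meaningful for non-null [a1] and [a2]: the denominator vanishes as
   soon as one of them is null. *)
Definition quadrance (F : qform) (a1 a2 : ppoint) : K :=
  let u := val (repr F) in
  let v1 := val (repr a1) in
  let v2 := val (repr a2) in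
  qform_disc u * cross v1 v2 ^+ 2 / (qform_val u v1 * qform_val u v2).

Lemma ppoint_eqP (x1 y1 x2 y2 : K) n1 n2 :
  (@ppoint_of x1 y1 n1 = @ppoint_of x2 y2 n2) <-> (x1 * y2 - x2 * y1 = 0).
Proof. by split=> [/eqmodP/eqP|/eqP E] //; apply/eqmodP. Qed.

Lemma qform_eqP (d e f d' e' f' : K) n n' :
  (@qform_of d e f n = @qform_of d' e' f' n') <->
  (exists2 c : K, c != 0 & (d', e', f') = (c * d, c * e, c * f)).
Proof. by split=> [/eqmodP/asboolP|/asboolP E] //; apply/eqmodP. Qed.

Lemma ppoint_ofP (a : ppoint) : exists x y n, a = @ppoint_of x y n.
Proof.
exists (val (repr a)).1, (val (repr a)).2.
rewrite -[a in exists n, a = _]reprK.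
by case: (repr a) => [[x y] n] /=; exists n.
Qed.

Lemma qform_ofP (F : qform) : exists d e f n, F = @qform_of d e f n.
Proof.
exists (val (repr F)).1.1, (val (repr F)).1.2, (val (repr F)).2.
rewrite -[F in exists n, F = _]reprK.
by case: (repr F) => [[[d e] f] n] /=; exists n.
Qed.

Lemma repr_ppoint_of (x y : K) n :
  exists2 c : K, c != 0 & val (repr (@ppoint_of x y n)) = (c * x, c * y).
Proof.
have /eqmodP/same_ppointP[c c0 E] : exist _ (x, y) n = repr (ppoint_of n) %[mod ppoint].
  by rewrite reprK.
by exists c.
Qed.

Lemma repr_qform_of (d e f : K) n :
  exists2 c : K, c != 0 & val (repr (@qform_of d e f n)) = (c * d, c * e, c * f).
Proof.
have /eqmodP/same_qformP[c c0 E] : exist _ (d, e, f) n = repr (qform_of n) %[mod qform].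
  by rewrite reprK.
by exists c.
Qed.

Lemma qform_nondegenerateE (d e f : K) n :
  qform_nondegenerate (@qform_of d e f n) = (d * f - e ^+ 2 != 0).
Proof.
rewrite /qform_nondegenerate; have [c c0 ->] := repr_qform_of n; rewrite /qform_disc.
have -> : c * d * (c * f) - (c * e) ^+ 2 = c ^+ 2 * (d * f - e ^+ 2) by ring.
by rewrite mulf_eq0 expf_eq0 (negPf c0).
Qed.

Lemma is_nullE (d e f x y : K) n m :
  is_null (@qform_of d e f n) (@ppoint_of x y m) =
  (d * x ^+ 2 + 2 * e * x * y + f * y ^+ 2 == 0).
Proof.
rewrite /is_null; have [c c0 ->] := repr_qform_of n.
have [b b0 ->] := repr_ppoint_of m; rewrite /qform_val.
set q := (X in _ = (X == 0)).
have -> : c * d * (b * x) ^+ 2 + 2 * (c * e) * (b * x) * (b * y) + c * f * (b * y) ^+ 2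
  = c * b ^+ 2 * q by rewrite /q; ring.
by rewrite !mulf_eq0 (negPf c0) (negPf b0).
Qed.

Lemma quadranceE (d e f x1 y1 x2 y2 : K) n m1 m2 :
  quadrance (@qform_of d e f n) (@ppoint_of x1 y1 m1) (@ppoint_of x2 y2 m2) =
  (d * f - e ^+ 2) * (x1 * y2 - x2 * y1) ^+ 2 /
  ((d * x1 ^+ 2 + 2 * e * x1 * y1 + f * y1 ^+ 2) *
   (d * x2 ^+ 2 + 2 * e * x2 * y2 + f * y2 ^+ 2)).
Proof.
rewrite /quadrance; have [c c0 ->] := repr_qform_of n.
have [b1 b10 ->] := repr_ppoint_of m1; have [b2 b20 ->] := repr_ppoint_of m2.
rewrite /qform_val /qform_disc /cross.
set D := (X in _ = _ / X); set N := (X in _ = X / _).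
set k := c ^+ 2 * (b1 ^+ 2 * b2 ^+ 2).
have k0 : k != 0 by rewrite !mulf_neq0.
transitivity ((k * N) / (k * D)); last by rewrite -mulf_div divff // mul1r.
by congr (_ / _); rewrite /k /N /D; ring.
Qed.

End Proportions.

(* Main.v *)
Require Import Defs.
From mathcomp Require Import all_boot all_order all_algebra.
From mathcomp Require Import ring.

Set Implicit Arguments.
Unset Strict Implicit.
Unset Printing Implicit Defensive.

Import GRing.Theory.
Local Open Scope ring_scope.

(** The formula is a Gram determinant identity in disguise.  Write [Q] for the
    quadratic form, [D] for its discriminant, [vi] for coordinates of the three
    points, and [c1], [c2], [c3] for the cross products of [v2 v3], [v1 v3] and
    [v1 v2].  The formula says that the Archimedes function
    [(A + B + C)^2 - 2 (A^2 + B^2 + C^2)] takes the value [4 q1 q2 q3] at the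
    quadrances.  It is homogeneous of degree 2, and
    [q1 = D / (Q v1 * Q v2 * Q v3) * (c1^2 * Q v1)], similarly for [q2] and
    [q3]; so the formula amounts to the value [4 D (c1 c2 c3)^2] at the
    numbers [ci^2 * Q vi] ([archimedes_cross]).

    Now [ci^2 * Q vi] is the value of [Q] at [ci * vi], and the three vectors
    of the plane satisfy [c1 v1 + c3 v3 = c2 v2] ([cross_relation]).  They are
    thus the sides of a triangle, and for the sides [v], [w], [v + w] of a
    triangle the Archimedes function of the values of [Q] is four times the Gram
    determinant of [v] and [w] ([archimedes_triangle]); in the plane this
    determinant is [D * cross v w ^+ 2] ([gram_cross]), and the cross product
    of [c1 v1] and [c3 v3] is [c1 c2 c3].  All identities hold over the
    integers, hence in every characteristic. *)

Section TripleQuad.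
Variable K : fieldType.
Implicit Types (c A B C : K) (u : K * K * K) (v w : K * K).

(** Sixteen times the squared area of a Euclidean triangle whose squared side
    lengths are [A], [B] and [C]. *)
Definition archimedes A B C := (A + B + C) ^+ 2 - 2 * (A ^+ 2 + B ^+ 2 + C ^+ 2).

(** Polarized without a factor [2], so that [qform_polar u v v] is
    [qform_val u v] in every characteristic. *)
Definition qform_polar u v w : K :=
  u.1.1 * v.1 * w.1 + u.1.2 * (v.1 * w.2 + v.2 * w.1) + u.2 * v.2 * w.2.

Definition scale2 c v : K * K := (c * v.1, c * v.2).

Lemma qform_val_scale u c v : qform_val u (scale2 c v) = c ^+ 2 * qform_val u v.
Proof. by case: u v => [[d e] f] [x y]; rewrite /qform_val /=; ring. Qed.

Lemma qform_valD u v w :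
  qform_val u (v + w) = qform_val u v + 2 * qform_polar u v w + qform_val u w.
Proof.
by case: u v w => [[d e] f] [x y] [z t]; rewrite /qform_polar /qform_val /=; ring.
Qed.

Lemma cross_scale c1 c2 v w : cross (scale2 c1 v) (scale2 c2 w) = c1 * c2 * cross v w.
Proof. by case: v w => [x y] [z t]; rewrite /cross /=; ring. Qed.

(** The Gram matrix of [v] and [w] is [M S M^T], where [S] is the matrix of the
    form and [M] has rows [v] and [w], so its determinant is the product of the
    discriminant and of the squared determinant of [M]. *)
Lemma gram_cross u v w :
  qform_val u v * qform_val u w - qform_polar u v w ^+ 2
  = qform_disc u * cross v w ^+ 2.
Proof.
case: u v w => [[d e] f] [x y] [z t].
by rewrite /qform_polar /qform_val /qform_disc /cross /=; ring.
Qed.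

(** Let [A], [B], [C] be the values of the form at [v], [w], [v + w], and [P] the
    polar value.  Since [C = A + B + 2 P], the Archimedes function, which is
    [4 A B - (A + B - C)^2], becomes [4 (A B - P^2)], a Gram determinant. *)
Lemma archimedes_triangle u v w :
  archimedes (qform_val u v) (qform_val u (v + w)) (qform_val u w)
  = 4 * qform_disc u * cross v w ^+ 2.
Proof. by rewrite -mulrA -gram_cross qform_valD /archimedes; ring. Qed.

(** Any three vectors of the plane are linearly dependent, with cross products
    as coefficients (Cramer's rule). *)
Lemma cross_relation v1 v2 v3 :
  scale2 (cross v1 v3) v2 = scale2 (cross v2 v3) v1 + scale2 (cross v1 v2) v3.
Proof.
case: v1 v2 v3 => [x1 y1] [x2 y2] [x3 y3]; rewrite /scale2 /cross /=.
by congr pair; rewrite /=; ring.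
Qed.

(** The triple quad formula with denominators cleared. *)
Lemma archimedes_cross u v1 v2 v3 :
  archimedes (cross v2 v3 ^+ 2 * qform_val u v1)
             (cross v1 v3 ^+ 2 * qform_val u v2)
             (cross v1 v2 ^+ 2 * qform_val u v3)
  = 4 * qform_disc u * (cross v2 v3 * cross v1 v3 * cross v1 v2) ^+ 2.
Proof.
rewrite -!qform_val_scale (cross_relation v1 v2 v3) archimedes_triangle cross_scale.
by ring.
Qed.

Lemma archimedesM c A B C :
  archimedes (c * A) (c * B) (c * C) = c ^+ 2 * archimedes A B C.
Proof. by rewrite /archimedes; ring. Qed.

End TripleQuad.

Theorem theorem8 (K : fieldType) (F : qform K) (hF : qform_nondegenerate F)
  (a1 a2 a3 : ppoint K)
  (h1 : ~~ is_null F a1) (h2 : ~~ is_null F a2) (h3 : ~~ is_null F a3) :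
  let q1 := quadrance F a2 a3 in
  let q2 := quadrance F a1 a3 in
  let q3 := quadrance F a1 a2 in
  (q1 + q2 + q3) ^+ 2
  = 2 * (q1 ^+ 2 + q2 ^+ 2 + q3 ^+ 2) + 4 * q1 * q2 * q3.
Proof.
move=> q1 q2 q3.
suff /(canRL (subrK _)) -> : archimedes q1 q2 q3 = 4 * q1 * q2 * q3 by rewrite addrC.
rewrite /q1 /q2 /q3 /quadrance.
move: h1 h2 h3; rewrite /is_null.
set u := val (repr F).
set v1 := val (repr a1); set v2 := val (repr a2); set v3 := val (repr a3).
have := archimedes_cross u v1 v2 v3.
(* The values of the form stay opaque, so that they are cancelled as atoms. *)
move: (qform_val u v1) (qform_val u v2) (qform_val u v3) (qform_disc u)
  (cross v2 v3) (cross v1 v3) (cross v1 v2) => N1 N2 N3 D c1 c2 c3 E n1 n2 n3.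
pose k := D / (N1 * N2 * N3).
have -> : D * c1 ^+ 2 / (N2 * N3) = k * (c1 ^+ 2 * N1).
  by rewrite /k; field; rewrite n1 n2 n3.
have -> : D * c2 ^+ 2 / (N1 * N3) = k * (c2 ^+ 2 * N2).
  by rewrite /k; field; rewrite n1 n2 n3.
have -> : D * c3 ^+ 2 / (N1 * N2) = k * (c3 ^+ 2 * N3).
  by rewrite /k; field; rewrite n1 n2 n3.
by rewrite archimedesM E /k; field; rewrite n1 n2 n3.
Qed.
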